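(* Let $(\mathcal{T}_r)_{r\in\mathbb{Z}}$ be a sequence of complex numbers satisfying $\mathcal{T}_r=\mathcal{T}_{r-1}+\mathcal{T}_{r-2}+\mathcal{T}_{r-3}$ for all integers $r$, and let $x$ be a complex number such that $x^k\mathcal{T}_k^2\to 0$ as $k\to\infty$. Then the series $\mathcal{G}(x)=\sum_{j=0}^\infty x^j\mathcal{T}_j^2$ converges and \[ \begin{aligned} (1-3x-x^2-x^3)(1+x+x^2-x^3)\,\mathcal{G}(x) &= (2+3x+6x^2-x^3-x^5)\mathcal{T}_{-1}^2 + (3+6x-x^2-x^4)\mathcal{T}_{-2}^2\\ &\quad + (6-x-x^3)\mathcal{T}_{-3}^2 - (1+x^2)\mathcal{T}_{-4}^2 - x\mathcal{T}_{-5}^2 - \mathcal{T}_{-6}^2 . \end{aligned} \]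
   Context: A generalized Tribonacci sequence is determined by arbitrary initial values $\mathcal{T}_0,\mathcal{T}_1,\mathcal{T}_2$ and the recurrence $\mathcal{T}_r=\mathcal{T}_{r-1}+\mathcal{T}_{r-2}+\mathcal{T}_{r-3}$, extended to all integer indices. *)

(* Defs.v *)
From Stdlib Require Import Reals ZArith.
From Coquelicot Require Import Coquelicot.

Definition generalized_tribonacci (T : Z -> C) : Prop :=
  forall r : Z, T r = (T (r - 1)%Z + T (r - 2)%Z + T (r - 3)%Z)%C.

(* Main.v *)
(** Put [w_n = sqrt |x| ^ n * T_n], so that [|w_n|^2 = |x^n T_n^2|] and [w] tends
    to [0].  Since [X^3 - X^2 - X - 1] splits over [C], the sequence [w] is killed
    by a product of three operators [E - l] ([E] the shift).  A null sequence [u]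
    with [(E - l) u] geometrically decaying is itself geometrically decaying:
    iterate [u (n+1) = l u n + v n] forwards if [|l| < 1] and backwards from
    infinity if [|l| >= 1].  Hence [x^n T_n^2] decays geometrically and the series
    converges absolutely, even at the zeros of the left-hand polynomial.  Its value
    is then found by summing the recurrence
    [T_r^2 = 2 T_(r-1)^2 + 3 T_(r-2)^2 + 6 T_(r-3)^2 - T_(r-4)^2 - T_(r-6)^2]
    against [x^r]. *)

Require Import Defs.
From Stdlib Require Import Reals ZArith Lra Lia.
From Coquelicot Require Import Coquelicot.
Local Open Scope C_scope.

Definition geometric_decay (u : nat -> C) : Prop :=
  exists M rho : R, (0 <= rho < 1)%R /\
    forall n, (Cmod (u n) <= M * rho ^ n)%R.

Lemma geometric_decay_expanding (u : nat -> C) (l : C) :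
  (1 <= Cmod l)%R ->
  is_lim_seq (fun n => Cmod (u n)) 0%R ->
  geometric_decay (fun n => u (S n) - l * u n) ->
  geometric_decay u.
Proof.
  intros Hl Hu (M & rho & Hrho & HM).
  exists (M / (1 - rho))%R, rho; split; [exact Hrho|]; intros k.
  assert (step : forall n, (Cmod (u n) <= Cmod (u (S n)) + M * rho ^ n)%R).
  { intros n; specialize (HM n).
    pose proof (Cmod_triangle (u (S n)) (- (u (S n) - l * u n))) as Htri.
    rewrite Cmod_opp in Htri.
    replace (u (S n) + - (u (S n) - l * u n)) with (l * u n) in Htri by ring.
    rewrite Cmod_mult in Htri.
    pose proof (Cmod_ge_0 (u n)); nra. }
  (* The correction term is the sum of [M * rho ^ i] for [i] from [k] to [n + k - 1], in closed
     form. *)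
  assert (iter : forall n, (Cmod (u k) <=
     Cmod (u (n + k)%nat) + M / (1 - rho) * (rho ^ k - rho ^ (n + k)))%R).
  { induction n as [|n IH]; simpl.
    - lra.
    - specialize (step (n + k)%nat).
      replace (M / (1 - rho) * (rho ^ k - rho * rho ^ (n + k)))%R
        with (M / (1 - rho) * (rho ^ k - rho ^ (n + k)) + M * rho ^ (n + k))%R
        by (field; lra).
      lra. }
  assert (M_ge_0 : (0 <= M)%R).
  { specialize (HM O); simpl in HM.
    pose proof (Cmod_ge_0 (u 1%nat - l * u O)); lra. }
  assert (le_lim : Rbar_le (Cmod (u k)) (0 + M / (1 - rho) * rho ^ k)%R).
  { apply (is_lim_seq_le (fun _ => Cmod (u k))
      (fun n => Cmod (u (n + k)%nat) + M / (1 - rho) * rho ^ k)%R).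
    - intros n; specialize (iter n).
      assert (0 <= M / (1 - rho))%R
        by (apply Rmult_le_pos; [lra | apply Rlt_le, Rinv_0_lt_compat; lra]).
      assert (0 <= rho ^ (n + k))%R by (apply pow_le; lra).
      nra.
    - apply is_lim_seq_const.
    - apply is_lim_seq_plus'; [|apply is_lim_seq_const].
      apply (is_lim_seq_incr_n (fun n => Cmod (u n)) k); exact Hu. }
  simpl in le_lim; lra.
Qed.

Lemma geometric_decay_contracting (u : nat -> C) (l : C) :
  (Cmod l < 1)%R ->
  geometric_decay (fun n => u (S n) - l * u n) ->
  geometric_decay u.
Proof.
  intros Hl (M & rho & Hrho & HM).
  pose proof (Cmod_ge_0 l) as Hl0.
  pose proof (Rmax_l rho (Cmod l)) as Hmax1.
  pose proof (Rmax_r rho (Cmod l)) as Hmax2.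
  assert (Hmax : (Rmax rho (Cmod l) < 1)%R) by (apply Rmax_lub_lt; lra).
  (* The rate must exceed both [rho] and [Cmod l] strictly: if the two coincide, [u] may grow like
     [n * rho ^ n]. [K] covers the initial value and is large enough that [Cmod l * K + M <= K * s],
     which drives the induction. *)
  set (s := ((1 + Rmax rho (Cmod l)) / 2)%R).
  assert (Hs : (rho < s /\ Cmod l < s /\ s < 1)%R) by (unfold s; lra).
  set (K := Rmax (Cmod (u O)) (M / (s - Cmod l))).
  assert (HK : (M <= K * (s - Cmod l))%R).
  { apply (Rmult_le_reg_r (/ (s - Cmod l))).
    - apply Rinv_0_lt_compat; lra.
    - rewrite Rmult_assoc, Rinv_r, Rmult_1_r by lra; apply Rmax_r. }
  exists K, s; split; [lra|].
  induction n as [|n IH]; simpl.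
  - rewrite Rmult_1_r; apply Rmax_l.
  - specialize (HM n).
    pose proof (Cmod_triangle (u (S n) - l * u n) (l * u n)) as Htri.
    replace (u (S n) - l * u n + l * u n) with (u (S n)) in Htri by ring.
    rewrite Cmod_mult in Htri.
    assert (Hpow : (0 <= rho ^ n <= s ^ n)%R)
      by (split; [apply pow_le | apply pow_incr]; lra).
    assert (M_ge_0 : (0 <= M * rho ^ n)%R)
      by (eapply Rle_trans; [apply Cmod_ge_0 | exact HM]).
    assert (HMs : (M * rho ^ n <= K * (s - Cmod l) * s ^ n)%R).
    { assert (0 <= K)%R
        by (apply Rle_trans with (Cmod (u O)); [apply Cmod_ge_0 | apply Rmax_l]).
      assert (0 <= K * (s - Cmod l))%R by (apply Rmult_le_pos; lra).
      apply Rle_trans with (K * (s - Cmod l) * rho ^ n)%R.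
      - apply Rmult_le_compat_r; lra.
      - apply Rmult_le_compat_l; lra. }
    assert (Cmod l * Cmod (u n) <= Cmod l * (K * s ^ n))%R
      by (apply Rmult_le_compat_l; lra).
    lra.
Qed.

Lemma geometric_decay_shift_sub (u : nat -> C) (l : C) :
  is_lim_seq (fun n => Cmod (u n)) 0%R ->
  geometric_decay (fun n => u (S n) - l * u n) ->
  geometric_decay u.
Proof.
  intros Hu Hv; destruct (Rle_lt_dec 1 (Cmod l)) as [Hl|Hl].
  - exact (geometric_decay_expanding u l Hl Hu Hv).
  - exact (geometric_decay_contracting u l Hl Hv).
Qed.

Lemma shift_sub_null (u : nat -> C) (l : C) :
  is_lim_seq (fun n => Cmod (u n)) 0%R ->
  is_lim_seq (fun n => Cmod (u (S n) - l * u n)) 0%R.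
Proof.
  intros Hu.
  apply (is_lim_seq_le_le (fun _ => 0%R) _
           (fun n => Cmod (u (S n)) + Cmod l * Cmod (u n))%R).
  - intros n; split; [apply Cmod_ge_0|].
    rewrite <- Cmod_mult, <- (Cmod_opp (l * u n)); apply Cmod_triangle.
  - apply is_lim_seq_const.
  - replace (Finite 0) with (Finite (0 + Cmod l * 0)) by (f_equal; ring).
    apply is_lim_seq_plus'.
    + apply (is_lim_seq_incr_1 (fun n => Cmod (u n))); exact Hu.
    + apply (is_lim_seq_scal_l (fun n => Cmod (u n)) (Cmod l) 0%R); exact Hu.
Qed.

(** By Vieta the recurrence reads [(E - c) (E - b) (E - a) u = 0]. Decay passes from the zero
    sequence back to [u] one factor at a time, since each intermediate sequence is still null. *)
Lemma geometric_decay_order3 (u : nat -> C) (a b c : C) :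
  is_lim_seq (fun n => Cmod (u n)) 0%R ->
  (forall n, u (3 + n)%nat = (a + b + c) * u (2 + n)%nat
     - (a * b + b * c + c * a) * u (1 + n)%nat + a * b * c * u n) ->
  geometric_decay u.
Proof.
  intros Hu Hrec.
  pose proof (shift_sub_null u a Hu) as Hv.
  pose proof (shift_sub_null _ b Hv) as Hw.
  apply (geometric_decay_shift_sub u a Hu).
  apply (geometric_decay_shift_sub _ b Hv).
  apply (geometric_decay_shift_sub _ c Hw).
  exists 0%R, 0%R; split; [lra|]; intros n; simpl.
  specialize (Hrec n); simpl in Hrec; rewrite Hrec.
  match goal with |- (Cmod ?z <= _)%R => replace z with (RtoC 0) by ring end.
  rewrite Cmod_0; lra.
Qed.

Lemma tribonacci_roots : exists a b c : C,
  a + b + c = 1 /\ a * b + b * c + c * a = - (1) /\ a * b * c = 1.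
Proof.
  (* The cubic is [-22/27] at [5/3] and [1] at [2]. The lower endpoint [5/3] makes [3 * t - 5]
     nonnegative, so that [q] is a genuine real square root and the other two roots are
     [(1 - t) / 2] plus or minus [i q]. *)
  destruct (IVT_cor (fun t => t ^ 3 - t ^ 2 - t - 1)%R (5 / 3) 2)
    as (t & Ht & Hroot); [reg | lra | lra |].
  (* The cofactor of [X - t] has discriminant [- (3 t - 5) (t + 1) <= 0]. *)
  set (q := sqrt ((3 * t - 5) * (t + 1) / 4)).
  assert (Hq : (q * q = (3 * t - 5) * (t + 1) / 4)%R)
    by (apply sqrt_sqrt; nra).
  exists (RtoC t), ((1 - t) / 2, q)%R, ((1 - t) / 2, - q)%R.
  unfold Cplus, Cmult, Copp, RtoC; simpl.
  repeat split; f_equal; try field; try nra.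
Qed.

(** Weighting by [r ^ n] multiplies each characteristic root by [r]. *)
Lemma tribonacci_geometric_decay (T : Z -> C) (r : R) :
  generalized_tribonacci T ->
  is_lim_seq (fun n => Cmod (RtoC r ^ n * T (Z.of_nat n))) 0%R ->
  geometric_decay (fun n => RtoC r ^ n * T (Z.of_nat n)).
Proof.
  intros hT Hlim.
  destruct tribonacci_roots as (a & b & c & H1 & H2 & H3).
  apply (geometric_decay_order3 _ (r * a) (r * b) (r * c) Hlim).
  intros n.
  replace (r * a * (r * b) + r * b * (r * c) + r * c * (r * a))
    with (r ^ 2 * (a * b + b * c + c * a)) by ring.
  replace (r * a * (r * b) * (r * c)) with (r ^ 3 * (a * b * c)) by ring.
  replace (r * a + r * b + r * c) with (r * (a + b + c)) by ring.
  rewrite H1, H2, H3, !Cpow_add_r, (hT (Z.of_nat (3 + n))).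
  replace (Z.of_nat (3 + n) - 1)%Z with (Z.of_nat (2 + n)) by lia.
  replace (Z.of_nat (3 + n) - 2)%Z with (Z.of_nat (1 + n)) by lia.
  replace (Z.of_nat (3 + n) - 3)%Z with (Z.of_nat n) by lia.
  ring.
Qed.

Lemma ex_series_tribonacci_sqr (T : Z -> C) (x : C) :
  generalized_tribonacci T ->
  filterlim (fun k : nat => x ^ k * T (Z.of_nat k) ^ 2)
    eventually (locally (RtoC 0)) ->
  ex_series (fun k : nat => x ^ k * T (Z.of_nat k) ^ 2).
Proof.
  intros hT hx.
  set (r := sqrt (Cmod x)).
  assert (Hr : (r * r = Cmod x)%R) by apply sqrt_sqrt, Cmod_ge_0.
  assert (Hsqr : forall n, Cmod (x ^ n * T (Z.of_nat n) ^ 2) =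
                   (Cmod (RtoC r ^ n * T (Z.of_nat n)) ^ 2)%R).
  { intros n.
    rewrite !Cmod_mult, !Cmod_pow, Cmod_R, <- Hr, Rpow_mult_distr.
    rewrite (Rabs_pos_eq r) by apply sqrt_pos; ring. }
  assert (Hlim : is_lim_seq (fun n => Cmod (RtoC r ^ n * T (Z.of_nat n))) 0%R).
  { apply is_lim_seq_ext with (fun n => sqrt (Cmod (x ^ n * T (Z.of_nat n) ^ 2))).
    - intros n; rewrite Hsqr; apply sqrt_pow2, Cmod_ge_0.
    - rewrite <- sqrt_0, <- Cmod_0.
      apply (is_lim_seq_continuous sqrt
               (fun n => Cmod (x ^ n * T (Z.of_nat n) ^ 2)) (Cmod 0)).
      + apply continuity_pt_sqrt; rewrite Cmod_0; lra.
      + refine (filterlim_comp _ _ _ _ Cmod _ _ _ hx _).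
        exact (filterlim_norm (V := C_NormedModule) (RtoC 0)). }
  destruct (tribonacci_geometric_decay T r hT Hlim) as (M & rho & Hrho & HM).
  apply (ex_series_le (V := C_CompleteNormedModule) _
           (fun n => M ^ 2 * (rho ^ 2) ^ n)%R).
  - intros n; change (Cmod (x ^ n * T (Z.of_nat n) ^ 2) <= M ^ 2 * (rho ^ 2) ^ n)%R.
    rewrite Hsqr, <- pow_mult, Nat.mul_comm, pow_mult, <- Rpow_mult_distr.
    apply pow_incr; split; [apply Cmod_ge_0 | apply HM].
  - apply (ex_series_scal_l (V := R_NormedModule)).
    apply ex_series_geom; rewrite Rabs_pos_eq; nra.
Qed.

(** Written in terms of [T (r - 4)], [T (r - 5)] and [T (r - 6)], both sides are the same quadratic
    form. The coefficients are those of the left-hand polynomial of the theorem,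
    [1 - 2 x - 3 x^2 - 6 x^3 + x^4 + x^6] once expanded. *)
Lemma tribonacci_sqr_rec (T : Z -> C) (r : Z) :
  generalized_tribonacci T ->
  T r ^ 2 = 2 * T (r - 1)%Z ^ 2 + 3 * T (r - 2)%Z ^ 2 + 6 * T (r - 3)%Z ^ 2
            - T (r - 4)%Z ^ 2 - T (r - 6)%Z ^ 2.
Proof.
  intros hT.
  pose proof (hT r) as E0.
  pose proof (hT (r - 1)%Z) as E1.
  pose proof (hT (r - 2)%Z) as E2.
  pose proof (hT (r - 3)%Z) as E3.
  rewrite <- !Z.sub_add_distr in E1, E2, E3; simpl in E1, E2, E3.
  rewrite E0, E1, E2, E3; ring.
Qed.

(** Each further delay prepends one value at a negative index; iterating it produces the boundary
    terms on the right of the final identity. *)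
Lemma is_series_shift_index (a : Z -> C) (x S : C) (m : Z) :
  is_series (fun j : nat => x ^ j * a (Z.of_nat j - m)%Z) S ->
  is_series (fun j : nat => x ^ j * a (Z.of_nat j - (m + 1))%Z)
    (a (- (m + 1))%Z + x * S).
Proof.
  intros HS; apply is_series_decr_1.
  apply (is_series_scal x) in HS.
  match type of HS with is_series _ ?l =>
    match goal with |- is_series _ ?l' => replace l' with l end end.
  - apply is_series_ext with (2 := HS); intros n.
    change (x * (x ^ n * a (Z.of_nat n - m)%Z)
            = x ^ Datatypes.S n * a (Z.of_nat (Datatypes.S n) - (m + 1))%Z).
    replace (Z.of_nat (Datatypes.S n) - (m + 1))%Z with (Z.of_nat n - m)%Z by lia.
    rewrite Cpow_S; ring.
  - change (x * S = a (- (m + 1))%Z + x * S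
                    + - (x ^ 0 * a (Z.of_nat 0 - (m + 1))%Z)).
    replace (Z.of_nat 0 - (m + 1))%Z with (- (m + 1))%Z by lia.
    simpl; ring.
Qed.

Theorem theorem3 (T : Z -> C) (x : C)
  (hT : generalized_tribonacci T)
  (hx : filterlim (fun k : nat => x ^ k * T (Z.of_nat k) ^ 2)
          eventually (locally (RtoC 0))) :
  exists G : C,
    is_series (fun j : nat => x ^ j * T (Z.of_nat j) ^ 2) G /\
    (1 - 3 * x - x ^ 2 - x ^ 3) * (1 + x + x ^ 2 - x ^ 3) * G =
      (2 + 3 * x + 6 * x ^ 2 - x ^ 3 - x ^ 5) * T (-1)%Z ^ 2
      + (3 + 6 * x - x ^ 2 - x ^ 4) * T (-2)%Z ^ 2
      + (6 - x - x ^ 3) * T (-3)%Z ^ 2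
      - (1 + x ^ 2) * T (-4)%Z ^ 2
      - x * T (-5)%Z ^ 2
      - T (-6)%Z ^ 2.
Proof.
  destruct (ex_series_tribonacci_sqr T x hT hx) as [G HG].
  change C in G.
  exists G; split; [exact HG|].
  set (a := fun r : Z => T r ^ 2).
  assert (S0 : is_series (fun j : nat => x ^ j * a (Z.of_nat j - 0)%Z) G).
  { apply is_series_ext with (2 := HG); intros n; unfold a.
    now rewrite Z.sub_0_r. }
  pose proof (is_series_shift_index a x _ _ S0) as S1.
  pose proof (is_series_shift_index a x _ _ S1) as S2.
  pose proof (is_series_shift_index a x _ _ S2) as S3.
  pose proof (is_series_shift_index a x _ _ S3) as S4.
  pose proof (is_series_shift_index a x _ _ S4) as S5.
  pose proof (is_series_shift_index a x _ _ S5) as S6.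
  simpl in S1, S2, S3, S4, S5, S6.
  (* The weights are those of the recurrence for squares, which has no [T (r - 5)^2] term; [S5] only
     leads to [S6]. *)
  pose proof (is_series_plus _ _ _ _ (is_series_plus _ _ _ _ (is_series_plus _ _ _ _
    (is_series_plus _ _ _ _ (is_series_scal (RtoC 2) _ _ S1)
    (is_series_scal (RtoC 3) _ _ S2)) (is_series_scal (RtoC 6) _ _ S3))
    (is_series_scal (- RtoC 1) _ _ S4)) (is_series_scal (- RtoC 1) _ _ S6)) as HS.
  apply (is_series_ext _ (fun j : nat => x ^ j * T (Z.of_nat j) ^ 2)) in HS.
  (* The combined series has the terms of the original one, so uniqueness of the sum gives a linear
     equation for [G]; moving its multiples of [G] to the left yields the claim. *)
  - pose proof (filterlim_locally_unique (V := C_NormedModule) _ _ _ HG HS) as E.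
    clear HG HS S0 S1 S2 S3 S4 S5 S6.
    unfold plus, scal in E; simpl in E; unfold mult in E; simpl in E.
    match type of E with _ = ?rhs => assert (D : G - rhs = 0) by (rewrite <- E; ring) end.
    unfold a in D.
    match goal with |- ?l = ?r => assert (D' : l - r = 0) by (rewrite <- D; ring) end.
    match goal with |- ?l = ?r =>
      replace l with (l - r + r) by ring; rewrite D'; ring end.
  - intros n; unfold plus, scal; simpl; unfold mult; simpl.
    pose proof (tribonacci_sqr_rec T (Z.of_nat n) hT) as E; simpl in E.
    rewrite E; unfold a; ring.
Qed.
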